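(* Let $F$ and $H$ be graphs with $r+1=\chi(F)>\chi(H)$, assume that $H$ is a forest that is both $F$-Turán-stable and $F$-Turán-good, and assume that $\mathrm{biex}(n,F)=O(1)$. Then for $n$ sufficiently large, $\mathrm{ex}(n,H,F)=\mathcal{N}(H,G)$ for some $n$-vertex $F$-free graph $G$ with $|E(G)|=\mathrm{ex}(n,F)$.
   Context: All graphs are finite and simple. $\mathrm{ex}(n,F)$ is the maximum number of edges in an $n$-vertex $F$-free graph. $\mathcal{N}(H,G)$ is the number of subgraphs of $G$ isomorphic to $H$, and $\mathrm{ex}(n,H,F)$ is the maximum of $\mathcal{N}(H,G)$ over $n$-vertex $F$-free graphs $G$. $T(n,r)$ is the Turán graph: the complete $r$-partite $n$-vertex graph with parts of sizes $\lfloor n/r\rfloor$ or $\lceil n/r\rceil$. $H$ is $F$-Turán-good if $\chi(H)<\chi(F)$ and $\mathrm{ex}(n,H,F)=\mathcal{N}(H,T(n,\chi(F)-1))$ for all sufficiently large $n$. The edit distance between two graphs on the same vertex set is the least number of edges one must add and delete to turn one into the other. $H$ is $F$-Turán-stable if every $n$-vertex $F$-free graph $G$ with $\mathcal{N}(H,G)\ge \mathrm{ex}(n,H,F)-o(n^{|V(H)|})$ has edit distance $o(n^2)$ from some graph on $V(G)$ isomorphic to $T(n,\chi(F)-1)$ (asymptotics as $n\to\infty$ with $F,H$ fixed). For a graph $F$ with $\chi(F)=r+1$, the decomposition family $\mathcal{D}(F)$ is the set of bipartite graphs obtained from $F$ by deleting $r-1$ color classes of a proper $(r+1)$-coloring of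 $F$, and $\mathrm{biex}(n,F)$ is the maximum number of edges in an $n$-vertex graph containing no member of $\mathcal{D}(F)$. *)

(* Defs.v *)
(* Finite simple graphs on vertex set 'I_k, given by their
   edge set E : {set {set 'I_k}} (every edge is a 2-element vertex set). *)
From mathcomp Require Import all_boot all_order all_fingroup all_algebra.
Set Implicit Arguments. Unset Strict Implicit. Unset Printing Implicit Defensive.
Import Order.TTheory GRing.Theory Num.Theory.

Notation graph k := {set {set 'I_k}}.

Definition is_graph k (E : graph k) : bool := [forall e in E, #|e| == 2].

Definition adj k (E : graph k) (x y : 'I_k) : bool := [set x; y] \in E.

Definition copies kH (EH : graph kH) n (EG : graph n) :
  {set {set 'I_n} * {set {set 'I_n}}} :=
  [set p : {set 'I_n} * {set {set 'I_n}} | [exists f : {ffun 'I_kH -> 'I_n},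
              [&& injectiveb f, p.1 == f @: setT & p.2 == ((fun e : {set 'I_kH} => f @: e) @: EH)]]
           && (p.2 \subset EG)].

Definition Ncount kH (EH : graph kH) n (EG : graph n) : nat := #|copies EH EG|.

Definition is_free kF (EF : graph kF) n (EG : graph n) : bool := Ncount EF EG == 0.

Definition ex (n : nat) kF (EF : graph kF) : nat :=
  \max_(E : graph n | is_graph E && is_free EF E) #|E|.

Definition exH (n : nat) kH (EH : graph kH) kF (EF : graph kF) : nat :=
  \max_(E : graph n | is_graph E && is_free EF E) Ncount EH E.

Definition proper_col m (E : graph m) c (col : {ffun 'I_m -> 'I_c}) : bool :=
  [forall e in E, #|col @: e| == 2].

Definition colorable m (E : graph m) (c : nat) : bool :=
  [exists col : {ffun 'I_m -> 'I_c}, proper_col E col].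

(* chromatic number: least c such that E is c-colourable (c <= m always works) *)
Definition chi m (E : graph m) : nat := find (colorable E) (iota 0 m.+1).

Definition turan (n r : nat) : graph n :=
  [set e : {set 'I_n} | (#|e| == 2) &&
     [forall x in e, forall y in e, (x != y) ==> (x %% r != y %% r)]].

Definition forest k (E : graph k) : Prop :=
  ~ exists s : seq 'I_k, [/\ 3 <= size s, uniq s & path.cycle (adj E) s].

Definition edit_dist n (E1 E2 : graph n) : nat := #|(E1 :\: E2) :|: (E2 :\: E1)|.

Definition perm_graph n (s : {perm 'I_n}) (E : graph n) : graph n :=
  ((fun e : {set 'I_n} => s @: e) @: E).

Definition turan_good kH (EH : graph kH) kF (EF : graph kF) : Prop :=
  chi EH < chi EF /\
  exists n0, forall n, n0 <= n ->
    exH n EH EF = Ncount EH (turan n (chi EF).-1).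

(* F-Turán-stable, with o(.) made explicit by eps/delta quantifiers *)
Definition turan_stable kH (EH : graph kH) kF (EF : graph kF) : Prop :=
  forall eps : rat, (0 < eps)%R ->
  exists delta : rat, (0 < delta)%R /\
  exists n0, forall n, n0 <= n -> forall EG : graph n,
    is_graph EG -> is_free EF EG ->
    ((Ncount EH EG)%:R >= (exH n EH EF)%:R - delta * n%:R ^+ kH :> rat)%R ->
    exists s : {perm 'I_n},
      ((edit_dist EG (perm_graph s (turan n (chi EF).-1)))%:R <= eps * n%:R ^+ 2 :> rat)%R.

(* G contains a member of the decomposition family D(F): for some proper
   chi(F)-colouring of F and two distinct colours a, b (i.e. after deleting the
   other chi(F)-2 colour classes), the induced subgraph of F on the classes a, b
   embeds into G as a (not necessarily induced) subgraph. *)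
Definition containsD kF (EF : graph kF) n (EG : graph n) : bool :=
  [exists col : {ffun 'I_kF -> 'I_(chi EF)},
    proper_col EF col &&
    [exists a : 'I_(chi EF), exists b : 'I_(chi EF),
      (a != b) &&
      [exists f : {ffun 'I_kF -> 'I_n},
        let S := [set x | (col x == a) || (col x == b)] in
        [forall x in S, forall y in S, (f x == f y) ==> (x == y)] &&
        [forall e in EF, (e \subset S) ==> (f @: e \in EG)]]]].

Definition biex (n : nat) kF (EF : graph kF) : nat :=
  \max_(E : graph n | is_graph E && ~~ containsD EF E) #|E|.

(* Main.v *)
Require Import Defs.
From mathcomp Require Import all_boot all_order all_fingroup all_algebra.
From mathcomp Require Import zify.
Set Implicit Arguments. Unset Strict Implicit. Unset Printing Implicit Defensive.
Import Order.TTheory GRing.Theory Num.Theory.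

(** If H has no edge, all n-vertex graphs have the same number of copies of H, so
    any F-free graph with ex(n,F) edges will do. Otherwise the Turan graph itself
    will do, because F then has a colour-critical edge: for an edge xy of H at a
    leaf x, recolouring x like y in an r-colouring of H embeds H in T(n,r) plus
    one edge, and this adds a copy of H, so by Turan-goodness that graph
    contains F. It remains to prove ex(n,F) = e(T(n,r)), as in Simonovits'
    critical edge theorem. Deleting vertices of low degree from an F-free graph
    with more edges leaves a large induced subgraph G, still with more edges than
    the Turan graph of its order and with at least (nearly) its minimum degree.
    Building the forest H leaf by leaf shows that such a G has asymptotically at
    least as many copies of H as the Turan graph, so Turan-stability puts G close
    to the Turan graph. Greedy embeddings of F then show that G is r-partite,
    which bounds its number of edges by that of the Turan graph. *)

(** * Adjacency, colourings, Turan graphs and leaves of forests *)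

Lemma adjC k (E : graph k) x y : adj E x y = adj E y x.
Proof. by rewrite /adj setUC. Qed.

Lemma adj_neq k (E : graph k) x y : is_graph E -> adj E x y -> x != y.
Proof.
by move=> /forall_inP gE /gE; rewrite cards2; case: (x != y).
Qed.

Lemma edgeP k (E : graph k) e : is_graph E -> e \in E ->
  exists x y, [/\ x != y, adj E x y & e = [set x; y]].
Proof.
move=> /forall_inP gE eE; have /cards2P[x [y [nxy De]]] := gE e eE.
by exists x, y; rewrite /adj -De.
Qed.

Lemma imset_pair (aT rT : finType) (f : aT -> rT) x y :
  f @: [set x; y] = [set f x; f y].
Proof. by rewrite imsetU !imset_set1. Qed.

Lemma containsP kF (EF : graph kF) n (EG : graph n) :
  reflect (exists2 f : {ffun 'I_kF -> 'I_n}, injective f &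
             forall e, e \in EF -> f @: e \in EG)
          (~~ is_free EF EG).
Proof.
rewrite /is_free /Ncount cards_eq0; apply: (iffP (set0Pn _)) => [[p]|[f injf fE]].
  rewrite !inE => /andP[/existsP[f /and3P[injf _ /eqP p2]] sp].
  exists f; first exact/injectiveP.
  by move=> e eE; apply: (subsetP sp); rewrite p2; apply: imset_f.
exists (f @: setT, (fun e : {set 'I_kF} => f @: e) @: EF).
rewrite inE; apply/andP; split.
  by apply/existsP; exists f; rewrite !eqxx !andbT; apply/injectiveP.
by apply/subsetP=> _ /imsetP[e eE ->]; apply: fE.
Qed.

Lemma free_embed kF (EF : graph kF) n (EG : graph n) (f : 'I_kF -> 'I_n) :
  is_graph EF -> is_free EF EG -> injective f ->
  (forall x y, adj EF x y -> adj EG (f x) (f y)) -> False.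
Proof.
move=> gF free injf fE; move: free; apply/negP/containsP; exists (finfun f).
  by move=> x y; rewrite !ffunE => /injf.
move=> e eE; have [x [y [_ xy ->]]] := edgeP gF eE.
by rewrite imset_pair !ffunE; apply: fE.
Qed.

Lemma proper_colP m (E : graph m) c (col : {ffun 'I_m -> 'I_c}) : is_graph E ->
  reflect (forall x y, adj E x y -> col x != col y) (proper_col E col).
Proof.
move=> gE; apply: (iffP forall_inP) => [pE x y xy|pE e eE].
  by have := pE _ xy; rewrite imset_pair cards2; case: (_ != _).
by have [x [y [_ xy ->]]] := edgeP gE eE; rewrite imset_pair cards2 pE.
Qed.

Lemma colorableP m (E : graph m) c : is_graph E ->
  colorable E c <-> exists col : 'I_m -> 'I_c, forall x y, adj E x y -> col x != col y.
Proof.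
move=> gE; split=> [/existsP[col /(proper_colP _ gE) pc]|[col pc]]; first by exists col.
by apply/existsP; exists (finfun col); apply/proper_colP => // x y /pc; rewrite !ffunE.
Qed.

Lemma colorable_chi m (E : graph m) : is_graph E -> colorable E (chi E).
Proof.
move=> gE; have cm: colorable E m.
  by apply/colorableP => //; exists id => x y /adj_neq; apply.
have hs : has (colorable E) (iota 0 m.+1).
  by apply/hasP; exists m => //; rewrite mem_iota /=.
have := nth_find 0 hs; rewrite nth_iota ?add0n //.
by move: hs; rewrite has_find size_iota.
Qed.

Lemma chi_leq m (E : graph m) c : colorable E c -> chi E <= c.
Proof.
move=> cE; rewrite leqNgt; apply/negP => lt_c.
have := before_find 0 lt_c; rewrite nth_iota ?add0n ?cE //.
by apply: leq_trans lt_c _; rewrite -[leqRHS](size_iota 0); apply: find_size.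
Qed.

Lemma colorable_leq m (E : graph m) c c' : is_graph E -> c <= c' ->
  colorable E c -> colorable E c'.
Proof.
move=> gE le_c /(colorableP _ gE)[col pc]; apply/colorableP => //.
by exists (fun x => widen_ord le_c (col x)) => x y /pc.
Qed.

Lemma adj_turan n r (x y : 'I_n) : adj (turan n r) x y = (x %% r != y %% r).
Proof.
rewrite /adj inE cards2; apply/andP/idP => [[xy /forall_inP /(_ x)]|ne].
  rewrite set21 => /(_ isT) /forall_inP /(_ y); rewrite set22 => /(_ isT).
  by move: xy; case: (x != y).
have -> : x != y by apply: contraNneq ne => ->.
split=> //; apply/forall_inP => u /set2P[] ->; apply/forall_inP => v /set2P[] ->;
 rewrite ?eqxx //; apply/implyP => _ //; by rewrite eq_sym.
Qed.

Lemma turan_graph n r : is_graph (turan n r).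
Proof. by apply/forall_inP => e; rewrite inE => /andP[]. Qed.

Lemma turan_free kF (EF : graph kF) n r :
  is_graph EF -> 0 < r < chi EF -> is_free EF (turan n r).
Proof.
move=> gF /andP[r0 ltr]; apply: contraT => /containsP[f injf fE].
suff: colorable EF r by move=> /chi_leq; rewrite leqNgt ltr.
apply/colorableP => //; exists (fun x => Ordinal (ltn_pmod (f x) r0)) => x y xy.
by have := fE _ xy; rewrite imset_pair -[_ \in _]/(adj _ _ _) adj_turan.
Qed.

Lemma forest_sub k (E E' : graph k) : E' \subset E -> forest E -> forest E'.
Proof.
move=> sE fE [s [s3 us cs]]; apply: fE; exists s; split=> //.
by case: s cs {s3 us} => //= x s; apply: sub_path => u v; apply: (subsetP sE).
Qed.

(* The far end of a longest path is a leaf. *)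
Lemma forest_leaf k (E : graph k) : is_graph E -> forest E -> E != set0 ->
  exists x y, adj E x y /\ forall z, adj E x z -> z = y.
Proof.
move=> gE fE /set0Pn[e eE]; have [x0 [y0 [nxy0 xy0 _]]] := edgeP gE eE.
(* The path is prolonged at its head [x]; [d] bounds the room left, since a path has at most [k]
   vertices. *)
suff H d : forall x y s, path (adj E) x (y :: s) -> uniq (x :: y :: s) ->
    k - size s <= d -> exists x y, adj E x y /\ forall z, adj E x z -> z = y.
  by apply: (H (k - 0) x0 y0 [::]) => //=; rewrite ?inE ?nxy0 ?xy0.
elim: d => [|d IHd] x y s ps us le_d.
  have: size (x :: y :: s) <= k by rewrite -(card_uniqP us) -[leqRHS]card_ord max_card.
  rewrite /=; lia.
have /andP[xy _] := ps.
case: (pickP (fun z => adj E x z && (z != y))) => [z /andP[xz nzy]|no]; last first.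
  exists x, y; split=> // z xz; have := no z; rewrite xz /= => /negbFE/eqP //.
have nzx: z != x by rewrite eq_sym; apply: adj_neq xz.
case: (boolP (z \in s)) => zs.
  (* A second neighbour [z] on the path closes a cycle; it has length at least 3 because [z] differs
     from [y]. *)
  case/splitPr: zs ps us => p1 p2 ps us; case: fE.
  exists (x :: y :: rcons p1 z); split.
  - by rewrite /= size_rcons.
  - move: us; rewrite -cat_rcons -!cat_cons cat_uniq => /andP[] //.
  - move: ps; rewrite -cat_rcons -cat_cons cat_path => /andP[p _].
    by rewrite /path.cycle rcons_path p /= last_rcons adjC.
apply: (IHd z x (y :: s)) => //=; last by lia.
  by rewrite adjC xz.
by move: us => /= ->; rewrite !inE negb_or nzx negb_or nzy zs.
Qed.

(** * Edges and minimum degrees *)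

(* [reverse_coercion] makes equal cardinals look like different atoms to [lia]. *)
Ltac clia := unfold reverse_coercion in *; simpl in *; lia.

Definition edges_in n (E : graph n) (W : {set 'I_n}) := [set e in E | e \subset W].
Definition nbrs n (E : graph n) (x : 'I_n) := [set y | adj E x y].

(** For [n > 0] and [r > 0] this is n - ceil(n/r), the degree in T(n,r) of a vertex in a largest
    class. *)
Definition turan_mindeg r n := n.-1 - n.-1 %/ r.
(** In T(n,r) vertex [i] has [i %/ r] earlier vertices in its class, so the sum counts the edges by
    their larger endpoint. *)
Definition turan_size r n := \sum_(i < n) (i - i %/ r).

Lemma turan_sizeS r n : turan_size r n.+1 = turan_size r n + turan_mindeg r n.+1.
Proof. by rewrite /turan_size big_ord_recr. Qed.

Lemma turan_size_pred r n : 0 < n ->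
  turan_size r n = turan_size r n.-1 + turan_mindeg r n.
Proof. by case: n => // n _; rewrite turan_sizeS. Qed.

Lemma edges_in0 n (E : graph n) : is_graph E -> edges_in E set0 = set0.
Proof.
move=> gE; apply/setP => e; rewrite !inE subset0; apply/negP => /andP[eE /eqP e0].
by have := forall_inP gE e eE; rewrite e0 cards0.
Qed.

Lemma card_edges_inU1 n (E : graph n) (W : {set 'I_n}) v : is_graph E -> v \notin W ->
  #|edges_in E (v |: W)| = #|edges_in E W| + #|nbrs E v :&: W|.
Proof.
move=> gE vW; rewrite -(cardsID [set e : {set 'I_n} | v \in e] (edges_in E (v |: W))) addnC.
congr (_ + _).
  apply: eq_card => e; rewrite !inE andbA [_ && (e \in E)]andbC -andbA; congr (_ && _).
  apply/andP/idP => [[ve /subsetP eW]|eW].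
    apply/subsetP => x xe; have := eW x xe; rewrite !inE => /orP[/eqP xv|//].
    by rewrite -xv xe in ve.
  split; first by apply: contra vW; apply: (subsetP eW).
  exact: subset_trans eW (subsetUr _ _).
have inj : {in nbrs E v :&: W &, injective (fun w => [set v; w])}.
  move=> x y; rewrite !inE => /andP[_ xW] _ Exy.
  have : x \in [set v; y] by rewrite -Exy set22.
  by case/set2P => // xv; rewrite xv (negPf vW) in xW.
rewrite -(card_in_imset inj); apply: eq_card => e; apply/idP/imsetP => [|[w]].
  rewrite !inE => /andP[/andP[eE eW] ve].
  have [x [y [nxy xy De]]] := edgeP gE eE.
  have [w vw De'] : exists2 w, adj E v w & e = [set v; w].
    move: ve; rewrite De => /set2P[->|->]; first by exists y.
    by exists x; rewrite 1?adjC // setUC.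
  exists w => //; rewrite !inE vw /=.
  have := subsetP eW w; rewrite De' set22 !inE => /(_ isT) /orP[/eqP wv|//].
  by have := adj_neq gE vw; rewrite wv eqxx.
rewrite !inE => /andP[vw wW] ->; rewrite -[_ \in E]/(adj E v w) vw set21 andbT /=.
by apply/subsetP => x /set2P[] ->; rewrite !inE ?eqxx ?wW ?orbT.
Qed.

Lemma card_edges_inD1 n (E : graph n) (W : {set 'I_n}) v : is_graph E -> v \in W ->
  #|edges_in E W| = #|edges_in E (W :\ v)| + #|nbrs E v :&: W|.
Proof.
move=> gE vW; rewrite -{1}(setD1K vW) card_edges_inU1 ?setD11 //.
congr (_ + _); apply: eq_card => x; rewrite !inE.
case: (eqVneq x v) => //= ->.
by have -> : adj E v v = false by apply/negP => /(adj_neq gE); rewrite eqxx.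
Qed.

Lemma edges_inT n (E : graph n) : edges_in E setT = E.
Proof. by apply/setP => e; rewrite inE subsetT andbT. Qed.

Lemma edges_in_le_sqr n (E : graph n) (W : {set 'I_n}) : is_graph E -> #|edges_in E W| <= #|W| ^ 2.
Proof.
move=> gE; elim: {W}_.+1 {-2}W (ltnSn #|W|) => // d IHd W leW.
have [->|[v vW]] := set_0Vmem W; first by rewrite edges_in0 ?cards0.
have cW : #|W| = #|W :\ v|.+1 by rewrite (cardsD1 v W) vW.
have := IHd (W :\ v); rewrite (card_edges_inD1 gE vW).
have : #|nbrs E v :&: W| <= #|W| by rewrite subset_leq_card // subsetIr.
rewrite cW; nia.
Qed.

(* Each deletion of a vertex of degree below the minimum degree of the Turan
   graph increases the excess over the Turan number by one. *)
Lemma mindeg_subgraph n (E : graph n) r (W : {set 'I_n}) d : is_graph E ->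
  turan_size r #|W| + d < #|edges_in E W| ->
  exists2 W' : {set 'I_n}, turan_size r #|W'| + d + (#|W| - #|W'|) < #|edges_in E W'| &
    forall x, x \in W' -> turan_mindeg r #|W'| <= #|nbrs E x :&: W'|.
Proof.
move=> gE; elim: {W}_.+1 {-2}W d (ltnSn #|W|) => // N IHN W d leW exW.
case: (pickP (fun x => (x \in W) && (#|nbrs E x :&: W| < turan_mindeg r #|W|))).
  move=> v /andP[vW ltv].
  have cW : #|W| = #|W :\ v|.+1 by rewrite (cardsD1 v W) vW.
  have := card_edges_inD1 gE vW; have := turan_size_pred r (n := #|W|).
  rewrite cW /= => /(_ isT) Et Ee.
  have [||W' exW' degW'] := IHN (W :\ v) d.+1; first by clia.
    move: ltv exW; rewrite !cW Et Ee; clia.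
  by exists W' => //; clia.
move=> no; exists W; first by rewrite subnn addn0.
by move=> x xW; have := no x; rewrite xW /= => /negbT; rewrite -leqNgt.
Qed.

(** By pigeonhole some class has more than (|W|-1)/r vertices of [W]. A vertex of [W] in it has at
    most [turan_mindeg r #|W|] neighbours in [W]; delete it and induct. *)
Lemma partite_edges_in n (E : graph n) r (p : 'I_n -> 'I_r) (W : {set 'I_n}) : is_graph E ->
  (forall x y, adj E x y -> p x != p y) -> #|edges_in E W| <= turan_size r #|W|.
Proof.
move=> gE pE; elim: {W}_.+1 {-2}W (ltnSn #|W|) => // d IHd W leW.
have [->|[v0 vW0]] := set_0Vmem W; first by rewrite edges_in0 ?cards0.
have W0 : 0 < #|W| by apply/card_gt0P; exists v0.
have sumW : \sum_(i < r) #|W :&: [set x | p x == i]| = #|W|.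
  rewrite -sum1_card (partition_big p xpredT) //=; apply: eq_bigr => i _.
  by rewrite -sum1_card; apply: eq_bigl => x; rewrite !inE.
have [i lti] : exists i, #|W|.-1 %/ r < #|W :&: [set x | p x == i]|.
  apply/existsP; apply: contraT => /existsPn no.
  suff: #|W| <= r * (#|W|.-1 %/ r) by move=> h; have := leq_trunc_div #|W|.-1 r; clia.
  have <- : \sum_(i < r) #|W|.-1 %/ r = r * (#|W|.-1 %/ r) by rewrite sum_nat_const card_ord.
  rewrite -{1}sumW; apply: leq_sum => i _.
  by have := no i; rewrite -leqNgt.
have [v] : exists v, v \in W :&: [set x | p x == i].
  by apply/card_gt0P; apply: leq_ltn_trans lti.
rewrite !inE => /andP[vW /eqP pv].
have cW : #|W| = #|W :\ v|.+1 by rewrite (cardsD1 v W) vW.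
rewrite (card_edges_inD1 gE vW) turan_size_pred //.
apply: leq_add; first by rewrite cW; apply: IHd; clia.
have : #|nbrs E v :&: W| <= #|W :\: [set x | p x == i]|.
  apply/subset_leq_card/subsetP => x; rewrite !inE => /andP[vx ->].
  by have := pE _ _ vx; rewrite pv eq_sym => ->.
have := cardsID [set x | p x == i] W; rewrite /turan_mindeg; clia.
Qed.

(** The vertices are added in increasing order. The earlier non-neighbours of [m] share its residue,
    so [x %/ r] maps them injectively below [m %/ r]. *)
Lemma turan_size_le n r : 0 < r -> turan_size r n <= #|turan n r|.
Proof.
move=> r0; have gT := turan_graph n r; rewrite -(edges_inT (turan n r)).
suff H m : m <= n -> turan_size r m <= #|edges_in (turan n r) [set x : 'I_n | x < m]|.
  apply: leq_trans (H n (leqnn n)) _; apply/subset_leq_card/subsetP => e.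
  by rewrite !inE subsetT => /andP[->].
elim: m => [|m IHm] ltm; first by rewrite /turan_size big_ord0.
pose v := Ordinal ltm.
have -> : [set x : 'I_n | x < m.+1] = v |: [set x : 'I_n | x < m].
  by apply/setP => x; rewrite !inE ltnS leq_eqVlt -val_eqE.
rewrite card_edges_inU1 ?inE ?ltnn // turan_sizeS; apply: leq_add; first by apply: IHm; clia.
rewrite /turan_mindeg /= leq_subLR.
have cm : #|[set x : 'I_n | x < m]| = m.
  have -> : [set x : 'I_n | x < m] = [set widen_ord (ltnW ltm) x | x : 'I_m].
    apply/setP => x; rewrite inE; apply/idP/imsetP => [lx|[y _ ->]] /=; last by [].
    by exists (Ordinal lx) => //; apply: val_inj.
  by rewrite card_imset ?card_ord // => x y /(congr1 val) /= /val_inj.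
rewrite -[m in m <= _]cm -(cardsID (nbrs (turan n r) v)) addnC.
apply: leq_add; last by rewrite setIC.
have lt_div x : x \in [set x : 'I_n | x < m] :\: nbrs (turan n r) v ->
    x %% r = m %% r /\ x %/ r < m %/ r.
  rewrite !inE adj_turan negbK /= => /andP[/eqP mx ltx]; split=> //.
  have := divn_eq x r; have := divn_eq m r; rewrite -mx; nia.
(* The default [v] is never taken, as [x %/ r <= x < n]. *)
pose g (x : 'I_n) := insubd (v : 'I_n) (x %/ r) .
have gE x : x \in [set x : 'I_n | x < m] :\: nbrs (turan n r) v -> g x = x %/ r :> nat.
  by move=> xA; rewrite val_insubd (leq_ltn_trans (leq_div x r)).
have injg : {in [set x : 'I_n | x < m] :\: nbrs (turan n r) v &, injective g}.
  move=> x y xA yA /(congr1 val) /=; rewrite !gE // => Ed; apply: val_inj => /=.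
  by rewrite (divn_eq x r) (divn_eq y r) Ed (lt_div x xA).1 (lt_div y yA).1.
rewrite -(card_in_imset injg) cardE -(size_map val).
rewrite -[leqRHS](size_iota 0); apply: uniq_leq_size.
  by rewrite map_inj_uniq ?enum_uniq //; apply: val_inj.
move=> z /mapP[y]; rewrite mem_enum => /imsetP[x xA ->] ->.
by rewrite /= gE // mem_iota add0n (lt_div x xA).2.
Qed.

(** * Counting copies of forests *)

Definition upd k n (f : {ffun 'I_k -> 'I_n}) x z : {ffun 'I_k -> 'I_n} :=
  [ffun w => if w == x then z else f w].

Lemma updK k n (f : {ffun 'I_k -> 'I_n}) x z : upd (upd f x z) x (f x) = f.
Proof. by apply/ffunP => w; rewrite !ffunE; case: eqP => // ->. Qed.

Definition homs k (E : graph k) n (G : graph n) : {set {ffun 'I_k -> 'I_n}} :=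
  [set f : {ffun 'I_k -> 'I_n} | [forall e in E, f @: e \in G]].

Definition injs k (E : graph k) n (G : graph n) : {set {ffun 'I_k -> 'I_n}} :=
  [set f in homs E G | injectiveb f].

Lemma homsP k (E : graph k) n (G : graph n) (f : {ffun 'I_k -> 'I_n}) : is_graph E ->
  reflect (forall a b, adj E a b -> adj G (f a) (f b)) (f \in homs E G).
Proof.
move=> gE; rewrite inE; apply: (iffP forall_inP) => [fE a b /fE|fE e eE].
  by rewrite imset_pair.
by have [a [b [_ ab ->]]] := edgeP gE eE; rewrite imset_pair; apply: fE.
Qed.

(** Deleting the edge keeps [x] as an isolated vertex with an arbitrary image, whence the factor
    [n]. Both sides count pairs of a map and a vertex. *)
Lemma card_homs_leaf k (E : graph k) n (G : graph n) x y : is_graph E ->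
  adj E x y -> (forall z, adj E x z -> z = y) ->
  #|homs E G| * n = \sum_(f in homs (E :\ [set x; y]) G) #|nbrs G (f y)|.
Proof.
move=> gE xy leaf; have nxy := adj_neq gE xy.
have gE' : is_graph (E :\ [set x; y]).
  by apply/forall_inP => e /setD1P[_]; apply: (forall_inP gE).
have leafl z : adj E z x -> z = y by rewrite adjC => /leaf.
have updE f z : (upd f x z \in homs E G) =
    (f \in homs (E :\ [set x; y]) G) && (z \in nbrs G (f y)).
  rewrite [_ \in nbrs _ _]inE; apply/(homsP _ _ gE)/andP => [fE|[/(homsP _ _ gE') fE zy] a b ab].
    split; last by have := fE _ _ xy; rewrite !ffunE eqxx eq_sym (negPf nxy) adjC.
    apply/(homsP _ _ gE') => a b; rewrite /adj !inE => /andP[nab ab].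
    have := fE _ _ ab; rewrite !ffunE.
    have [ax|nax] := eqVneq a x; first by move: ab nab; rewrite ax => /leaf ->; rewrite eqxx.
    have [bx|nbx //] := eqVneq b x.
    by move: ab nab; rewrite bx => /leafl ->; rewrite setUC eqxx.
  rewrite !ffunE; have [ax|nax] := eqVneq a x.
    move: ab; rewrite ax => /leaf ->; rewrite eq_sym (negPf nxy) adjC; exact: zy.
  have [bx|nbx] := eqVneq b x.
    by move: ab; rewrite bx => /leafl ->; exact: zy.
  apply: fE => //; rewrite /adj !inE; apply/andP; split=> //.
  apply: contraNneq nax => Eab; have: x \in [set a; b] by rewrite Eab set21.
  by case/set2P => [->|xb] //; rewrite xb eqxx in nbx.
(* This involution swaps the image of [x] with the second component of the pair. *)
pose phi (p : {ffun 'I_k -> 'I_n} * 'I_n) := (upd p.1 x p.2, p.1 x).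
have phiK : cancel phi phi.
  by case=> f z; rewrite /phi /= updK ffunE eqxx.
have -> : #|homs E G| * n = #|setX (homs E G) [set: 'I_n]| by rewrite cardsX cardsT card_ord.
rewrite -(card_imset _ (can_inj phiK)).
rewrite (can2_imset_pre _ phiK phiK) -sum1_card.
rewrite (eq_bigl (fun p => (p.1 \in homs (E :\ [set x; y]) G) && (p.2 \in nbrs G (p.1 y)))).
  rewrite -(pair_big_dep (fun f => f \in homs (E :\ [set x; y]) G) (fun f z => z \in nbrs G (f y)) (fun _ _ => 1)) /=.
  by apply: eq_bigr => f _; rewrite sum1_card.
by case=> f z; rewrite [LHS]inE in_setX in_setT andbT updE.
Qed.

Lemma homs_set0 k n (G : graph n) : #|homs (set0 : graph k) G| = n ^ k.
Proof.
have -> : homs (set0 : graph k) G = setT.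
  by apply/setP => f; rewrite !inE; apply/forall_inP => e; rewrite inE.
by rewrite cardsT card_ffun !card_ord.
Qed.

Lemma homs_le k (E : graph k) n (G : graph n) : #|homs E G| <= n ^ k.
Proof. by apply: leq_trans (max_card _) _; rewrite card_ffun !card_ord. Qed.

(** Hanging a leaf back multiplies the count by at least d/n in [G] and at most (d+1)/n in [T]. Each
    edge thus costs an error of at most n^(k-1); the factor [n] avoids division. *)
Lemma homs_forest_le k (E : graph k) n (G T : graph n) d : is_graph E -> forest E ->
  0 < n -> d < n ->
  (forall x, d <= #|nbrs G x|) -> (forall x, #|nbrs T x| <= d.+1) ->
  n * #|homs E T| <= n * #|homs E G| + #|E| * n ^ k.
Proof.
move=> + + n0 ltd degG degT; elim: {E}_.+1 {-2}E (ltnSn #|E|) => // N IHN E ltN gE fE.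
have [->|E0] := eqVneq E set0; first by rewrite !homs_set0 cards0 addn0.
have [x [y [xy leaf]]] := forest_leaf gE fE E0.
set E' := E :\ [set x; y].
have gE' : is_graph E' by apply/forall_inP => e /setD1P[_]; apply: (forall_inP gE).
have cE : #|E| = #|E'|.+1.
  by rewrite (cardsD1 [set x; y]) -[_ \in E]/(adj E x y) xy.
have IH : n * #|homs E' T| <= n * #|homs E' G| + #|E'| * n ^ k.
  apply: IHN => //; first by rewrite -ltnS -cE.
  by apply: forest_sub fE; apply: subsetDl.
have hT : #|homs E T| * n <= #|homs E' T| * d.+1.
  by rewrite (card_homs_leaf _ gE xy leaf) -sum_nat_const; apply: leq_sum => f _.
have hG : #|homs E' G| * d <= #|homs E G| * n.
  by rewrite (card_homs_leaf _ gE xy leaf) -sum_nat_const; apply: leq_sum => f _.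
have hm := homs_le E' G.
rewrite cE -(leq_pmul2l n0).
move: (n ^ k) (#|homs E T|) (#|homs E G|) (#|homs E' T|) (#|homs E' G|) (#|E'|) IH hT hG hm.
move=> nk a b a' b' c IH hT hG hm.
apply: (@leq_trans (n * b' * d.+1 + c * nk * d.+1)); first by nia.
apply: (@leq_trans (n * (b' * d) + n * b' + c * nk * n)); first by nia.
nia.
Qed.

(** A non-injective map identifies one of at most k^2 pairs, and each pair is identified by at most
    n^(k-1) maps. *)
Lemma homs_injs_le k (E : graph k) n (G : graph n) :
  n * #|homs E G| <= n * #|injs E G| + k ^ 2 * n ^ k.
Proof.
pose C (p : 'I_k * 'I_k) := [set f : {ffun 'I_k -> 'I_n} | f p.1 == f p.2].
have CE p : p.1 != p.2 -> n * #|C p| <= n ^ k.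
  move=> np; have -> : n * #|C p| = #|setX (C p) [set: 'I_n]| by rewrite cardsX cardsT card_ord mulnC.
  (* The overwritten value at [p.1] can be recovered from the value at [p.2]. *)
  have inj : {in setX (C p) [set: 'I_n] &, injective (fun q => upd q.1 p.1 q.2)}.
    move=> [f z] [g w]; rewrite !inE /= !andbT => /eqP fp /eqP gp /ffunP Efg.
    have Ew t : t != p.1 -> f t = g t.
      by move=> nt; have := Efg t; rewrite !ffunE (negPf nt).
    have Ez : z = w by have := Efg p.1; rewrite !ffunE eqxx.
    rewrite Ez; congr (_, _); apply/ffunP => t.
    have [->|/Ew //] := eqVneq t p.1.
    by rewrite fp gp Ew // eq_sym.
  rewrite -(card_in_imset inj); apply: leq_trans (max_card _) _.
  by rewrite card_ffun !card_ord.
have sub : homs E G \subset injs E G :|: \bigcup_(p | p.1 != p.2) C p.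
  apply/subsetP => f fE; rewrite !in_setU [f \in injs _ _]inE fE /=.
  case: (boolP (injectiveb f)) => //= /injectivePn[a [b nab Eab]].
  by apply/bigcupP; exists (a, b) => //; rewrite inE /= Eab.
have h1 : #|\bigcup_(p | p.1 != p.2) C p| <= \sum_(p | p.1 != p.2) #|C p|.
  elim/big_rec2: _ => [|p A B _ le]; first by rewrite cards0.
  by apply: leq_trans (leq_card_setU _ _) _; rewrite leq_add2l.
have h2 : n * \sum_(p : 'I_k * 'I_k | p.1 != p.2) #|C p| <= k ^ 2 * n ^ k.
  rewrite big_distrr /=; apply: (@leq_trans (\sum_(p : 'I_k * 'I_k | p.1 != p.2) n ^ k)).
    by apply: leq_sum => p; apply: CE.
  rewrite sum_nat_const leq_mul2r; apply/orP; right.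
  by apply: leq_trans (max_card _) _; rewrite card_prod !card_ord.
apply: leq_trans (leq_add (leqnn _) h2); rewrite -mulnDr leq_mul2l; apply/orP; right.
apply: leq_trans (subset_leq_card sub) _.
by apply: leq_trans (leq_card_setU _ _) _; rewrite leq_add2l.
Qed.

Lemma imset_comp_ffun (aT bT cT : finType) (f : {ffun bT -> cT}) (g : {ffun aT -> bT}) (A : {set aT}) :
  [ffun x => f (g x)] @: A = f @: (g @: A).
Proof. by rewrite -imset_comp; apply: eq_imset => x; rewrite ffunE. Qed.

(* The injective homomorphisms onto a fixed copy of the source graph form a
   torsor under its automorphism group [injs E E]. *)
Lemma card_injs k (E : graph k) n (G : graph n) :
  #|injs E G| = Ncount E G * #|injs E E|.
Proof.
pose phi (f : {ffun 'I_k -> 'I_n}) := (f @: setT, (fun e : {set 'I_k} => f @: e) @: E).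
have phiC f : f \in injs E G -> phi f \in copies E G.
  rewrite !inE => /andP[/forall_inP fE injf]; apply/andP; split.
    by apply/existsP; exists f; rewrite injf !eqxx.
  by apply/subsetP => _ /imsetP[e eE ->]; apply: fE.
rewrite -sum1_card (partition_big phi (fun p => p \in copies E G)) //=.
rewrite /Ncount -sum_nat_const; apply: eq_bigr => p.
rewrite inE => /andP[/existsP[f0 /and3P[/injectiveP inj0 /eqP p1 /eqP p2]] sp].
have -> : p = phi f0 by case: p p1 p2 {sp} => a b /= -> ->.
have injc : injective (fun s : {ffun 'I_k -> 'I_k} => [ffun x => f0 (s x)]).
  by move=> s t /ffunP Est; apply/ffunP => x; have := Est x; rewrite !ffunE => /inj0.
rewrite sum1_card -(card_imset _ injc); apply: eq_card => f; apply/idP/imsetP => [|[s sE ->]].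
  rewrite unfold_in => /andP[+ /eqP[ET EE]]; rewrite !inE => /andP[_ /injectiveP injf].
  have /fin_all_exists[s sP] (x : 'I_k) : exists z, f x = f0 z.
    have: f x \in f0 @: setT by rewrite -ET imset_f.
    by case/imsetP => z _ ->; exists z.
  have Ef : f = [ffun x => f0 ((finfun s) x)] by apply/ffunP => x; rewrite !ffunE.
  exists (finfun s) => //; rewrite !inE; apply/andP; split; last first.
    by apply/injectiveP => a b; rewrite !ffunE => Eab; apply: injf; rewrite !sP Eab.
  apply/forall_inP => e eE; have: f @: e \in (fun e : {set 'I_k} => f0 @: e) @: E.
    by rewrite -EE; apply/imsetP; exists e.
  by case/imsetP => e' e'E; rewrite Ef imset_comp_ffun => /(imset_inj inj0) ->.
move: sE; rewrite !inE => /andP[/forall_inP sE /injectiveP inj_s].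
have sT : s @: setT = setT.
  by apply/eqP; rewrite eqEcard subsetT card_imset // leqnn.
have sEE : (fun e : {set 'I_k} => s @: e) @: E = E.
  apply/eqP; rewrite eqEcard (card_imset _ (imset_inj inj_s)) leqnn andbT.
  by apply/subsetP => _ /imsetP[e eE ->]; apply: sE.
have EE : (fun e : {set 'I_k} => [ffun x => f0 (s x)] @: e) @: E = (fun e : {set 'I_k} => f0 @: e) @: E.
  rewrite -[in RHS]sEE -[RHS]imset_comp; apply: eq_imset => e.
  by rewrite imset_comp_ffun.
rewrite unfold_in /phi imset_comp_ffun sT EE eqxx andbT !inE; apply/andP; split; last first.
  by apply/injectiveP => a b; rewrite !ffunE => /inj0 /inj_s.
apply/forall_inP => e eE; apply: (subsetP sp); rewrite p2 -EE.
by apply/imsetP; exists e.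
Qed.

(** Homomorphisms are compared first; injectivity costs a lower-order term on the [G] side only.
    Cancelling the positive number of automorphisms does not increase the error. *)
Lemma Ncount_forest_le k (E : graph k) n (G T : graph n) d : is_graph E -> forest E ->
  0 < n -> d < n ->
  (forall x, d <= #|nbrs G x|) -> (forall x, #|nbrs T x| <= d.+1) ->
  n * Ncount E T <= n * Ncount E G + (k ^ 2 + #|E|) * n ^ k.
Proof.
move=> gE fE n0 ltd degG degT.
have h1 := homs_forest_le gE fE n0 ltd degG degT.
have h2 := homs_injs_le E G.
have h3 : #|injs E T| <= #|homs E T|.
  by apply/subset_leq_card/subsetP => f; rewrite inE => /andP[].
have a0 : 0 < #|injs E E|.
  apply/card_gt0P; exists (finfun id); rewrite !inE; apply/andP; split; last first.
    by apply/injectiveP => a b; rewrite !ffunE.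
  by apply/forall_inP => e eE; rewrite (eq_imset (g := id)) ?imset_id // => x; rewrite ffunE.
move: h1 h2 h3; rewrite (card_injs E T) (card_injs E G).
move: #|injs E E| (Ncount E T) (Ncount E G) #|homs E T| #|homs E G| a0 => a t g hT hG a0 h1 h2 h3.
rewrite -(leq_pmul2l a0) mulnCA [a * t]mulnC.
apply: leq_trans (leq_mul (leqnn n) h3) _; apply: leq_trans h1 _.
rewrite mulnDr mulnDl addnC mulnCA [a * g]mulnC.
apply: leq_trans (leq_add (leqnn _) h2) _; rewrite addnCA leq_add2l addnC.
by apply: leq_pmull.
Qed.

(** * Colour-critical edges and greedy embedding *)

(** With r = chi(E) - 1 this says that uv is a colour-critical edge. *)
Definition one_bad_edge k (E : graph k) r (c : 'I_k -> 'I_r) u v :=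
  [/\ adj E u v, c u = c v &
      forall a b, adj E a b -> [set a; b] != [set u; v] -> c a != c b].

Lemma chi_gt1 k (E : graph k) x y : is_graph E -> adj E x y -> 1 < chi E.
Proof.
move=> gE xy; have /(colorableP _ gE)[col pc] := colorable_chi gE.
have := pc x y xy; rewrite -val_eqE /=.
have := ltn_ord (col x); have := ltn_ord (col y).
move: (chi E) (val _) (val _) => c a b; lia.
Qed.

Lemma good_critical kH (EH : graph kH) kF (EF : graph kF) : is_graph EH -> is_graph EF ->
  forest EH -> EH != set0 -> turan_good EH EF ->
  exists (c : 'I_kF -> 'I_(chi EF).-1) u v, one_bad_edge EF c u v.
Proof.
move=> gH gF fH H0 [lt_chi [n0 good]].
have [x [y [xy leaf]]] := forest_leaf gH fH H0.
have chi1 := chi_gt1 gH xy; have nxy := adj_neq gH xy.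
set r := (chi EF).-1; have r0 : 0 < r by lia.
have : colorable EH r by apply: colorable_leq (colorable_chi gH) => //; lia.
case/(colorableP _ gH) => col pc.
pose col' w := if w == x then col y else col w.
(* Large enough for goodness and for sending [w] to [col' w + r * w], which lies in the class of its
   colour and determines [w]. *)
pose n := n0 + r * kH.
have lt_n w : col' w + r * w < n.
  have := ltn_ord (col' w); have := ltn_ord w; rewrite /n; nia.
pose g : {ffun 'I_kH -> 'I_n} := [ffun w => Ordinal (lt_n w)].
have gmod w : g w %% r = col' w.
  by rewrite ffunE /= addnC mulnC modnMDl modn_small.
have injg : injective g.
  move=> a b Eab; have := congr1 val Eab; rewrite !ffunE /= => Ev.
  apply: val_inj; have := gmod a; rewrite Eab gmod => Ec.
  by move: Ev; rewrite Ec => /addnI/eqP; rewrite eqn_pmul2l // => /eqP.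
have gxy : g x %% r = g y %% r.
  by rewrite !gmod /col' eqxx eq_sym (negPf nxy).
pose T' := [set g x; g y] |: turan n r.
have gT' : is_graph T'.
  apply/forall_inP => e /setU1P[->|]; last exact: (forall_inP (turan_graph n r)).
  by rewrite cards2 (inj_eq injg) nxy.
have notT : [set g x; g y] \notin turan n r.
  by rewrite -[_ \in _]/(adj _ _ _) adj_turan gxy eqxx.
have gE a b : adj EH a b -> [set g a; g b] \in T'.
  move=> ab; rewrite in_setU1; have [Eax|nax] := eqVneq a x.
    by move: ab; rewrite Eax => /leaf ->; rewrite eqxx.
  have [Ebx|nbx] := eqVneq b x.
    by move: ab; rewrite Ebx adjC => /leaf ->; rewrite setUC eqxx.
  rewrite -[X in _ || X]/(adj _ _ _) adj_turan !gmod /col' (negPf nax) (negPf nbx).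
  by rewrite (pc a b ab) orbT.
(* All copies of H in the Turan graph survive in [T'], and the image of [g] is a new one through the
   added edge. *)
have : ~~ is_free EF T'.
  apply/negP => freeT'.
  have : Ncount EH T' <= exH n EH EF.
    by rewrite /exH (bigD1 T') ?gT' ?freeT' //= leq_maxl.
  rewrite good ?leq_addr // leqNgt => /negP[].
  apply/proper_card/properP; split.
    apply/subsetP => p; rewrite !inE => /andP[-> /subset_trans -> //].
    exact: subsetUr.
  exists (g @: setT, (fun e : {set 'I_kH} => g @: e) @: EH).
    rewrite inE; apply/andP; split.
      by apply/existsP; exists g; rewrite !eqxx !andbT; apply/injectiveP.
    apply/subsetP => _ /imsetP[e eE ->]; have [a [b [_ ab ->]]] := edgeP gH eE.
    by rewrite imset_pair gE.
  rewrite inE; apply/negP => /andP[_ /subsetP sub].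
  move/negP: notT; apply; apply: sub.
  by apply/imsetP; exists [set x; y] => //; rewrite imset_pair.
case/containsP => f injf fE.
have : [exists e in EF, f @: e == [set g x; g y]].
  have lt_r : 0 < r < chi EF by rewrite r0 /r; lia.
  have := turan_free n gF lt_r.
  apply: contraLR => /exists_inPn no; apply/containsP; exists f => // e eE.
  by have := fE e eE; rewrite in_setU1 (negPf (no e eE)).
case/exists_inP => e0 e0E /eqP fe0; have [u [v [_ uv De0]]] := edgeP gF e0E.
(* Residues of the embedding colour F, and only the edge sent to the added one is monochromatic. *)
exists (fun w => Ordinal (ltn_pmod (f w) r0)), u, v; split=> //.
  apply: val_inj => /=; move: fe0; rewrite De0 imset_pair => Euv.
  have: f u \in [set g x; g y] by rewrite -Euv set21.
  have: f v \in [set g x; g y] by rewrite -Euv set22.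
  by case/set2P => -> /set2P[] ->.
move=> a b ab nab; rewrite -val_eqE /= -(adj_turan r).
have := fE _ ab; rewrite in_setU1 -fe0 (inj_eq (imset_inj injf)) De0 (negPf nab).
by rewrite imset_pair.
Qed.

(** Vertices are placed one by one: each vertex already placed excludes itself and at most [b]
    non-neighbours, so fewer than |S i| candidates are lost. *)
Lemma greedy_partite_embed m (G : graph m) r (S : 'I_r -> {set 'I_m}) b k (c : 'I_k -> 'I_r) : is_graph G ->
  (forall i j w, i != j -> w \in S i -> #|S j :\: nbrs G w| <= b) ->
  (forall i, k * b.+1 < #|S i|) ->
  exists f : 'I_k -> 'I_m,
    [/\ forall x, f x \in S (c x), injective f &
        forall x y, c x != c y -> adj G (f x) (f y)].
Proof.
move=> gG few big.
(* Values outside [xs] are placeholders, constrained only to lie in the right set. *)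
suff H (xs : seq 'I_k) : uniq xs -> exists f : 'I_k -> 'I_m,
    [/\ forall x, f x \in S (c x), {in xs &, injective f} &
        {in xs &, forall x y, c x != c y -> adj G (f x) (f y)}].
  have [f [fS injf fG]] := H (enum 'I_k) (enum_uniq _).
  by exists f; split=> // x y; [apply: injf | apply: fG]; rewrite mem_enum.
elim: xs => [|x xs IHxs] /=.
  move=> _; have /fin_all_exists[f fS] (x : 'I_k) : exists z, z \in S (c x).
    by apply/card_gt0P; apply: leq_ltn_trans (big (c x)).
  by exists f; split.
case/andP => xxs uxs; have [f [fS injf fG]] := IHxs uxs.
pose B y := f y |: (if c y == c x then set0 else S (c x) :\: nbrs G (f y)).
have cB y : #|B y| <= b.+1.
  apply: leq_trans (leq_card_setU _ _) _; rewrite cards1 add1n ltnS.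
  by case: eqP => [_|/eqP ne]; [rewrite cards0 | apply: few ne (fS y)].
have cBs : #|\bigcup_(y <- xs) B y| <= size xs * b.+1.
  elim: (xs) => [|y ys IH]; first by rewrite big_nil cards0.
  rewrite big_cons mulSn; apply: leq_trans (leq_card_setU _ _) _.
  exact: leq_add (cB y) IH.
have [z zS zB] : exists2 z, z \in S (c x) & z \notin \bigcup_(y <- xs) B y.
  apply/subsetPn/negP => /subset_leq_card.
  apply/negP; rewrite -ltnNge; apply: leq_ltn_trans cBs _; apply: leq_ltn_trans (big (c x)).
  rewrite leq_mul2r; apply/orP; right; rewrite -(card_uniqP uxs) -[leqRHS]card_ord.
  exact: max_card.
have zP y : y \in xs -> z != f y /\ (c y != c x -> adj G (f y) z).
  move=> yxs; have : z \notin B y by apply: contra zB => zy; rewrite (big_rem y yxs) /= inE zy.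
  rewrite !inE negb_or => /andP[-> zy]; split=> // ne.
  by move: zy; rewrite (negPf ne) !inE zS andbT negbK.
exists (fun w => if w == x then z else f w); split.
- by move=> w; case: eqP => [->|].
- move=> a a'; rewrite !inE.
  have [-> _|na /= axs] := eqVneq a x; have [-> _|na' /= axs'] := eqVneq a' x => //.
  + by move=> E; have [] := zP _ axs'; rewrite E eqxx.
  + by move=> E; have [] := zP _ axs; rewrite E eqxx.
  exact: injf.
move=> a a'; rewrite !inE.
have [-> _|na /= axs] := eqVneq a x; have [-> _|na' /= axs'] := eqVneq a' x.
- by rewrite eqxx.
- by rewrite eq_sym adjC; case: (zP _ axs').
- by case: (zP _ axs).
exact: fG.
Qed.

Lemma card_setIDC (T : finType) (A B C : {set T}) : #|A| <= #|A :&: B :\: C| + #|C| + #|A :\: B|.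
Proof.
rewrite -(cardsID B A) leq_add2r -(cardsID C (A :&: B)) addnC leq_add2l.
by apply/subset_leq_card/subsetIr.
Qed.

(* [B] collects the vertices whose neighbourhood differs much from that in the
   Turan graph. A vertex with many neighbours in every part [V i] could play [u0]
   in a copy of F, so each vertex [v] has few neighbours in some part [V (p v)].
   Two adjacent vertices with the same [p] could then play [u0] and [v0], the
   rest of F being embedded greedily outside [B] among their common neighbours. *)
Lemma near_turan_partite kF (EF : graph kF) r (c0 : 'I_kF -> 'I_r) u0 v0 m (G : graph m)
    (P : 'I_m -> 'I_r) q M :
  is_graph EF -> one_bad_edge EF c0 u0 v0 -> is_graph G -> is_free EF G ->
  q = 8 * r -> M = 8 * (4 * kF * q) * q -> M <= m ->
  (forall i, m %/ r <= #|[set x | P x == i]|) ->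
  (forall x, turan_mindeg r m <= #|nbrs G x|) ->
  M * (\sum_x #|[set y | adj G x y != (P x != P y)]|) <= 2 * m ^ 2 ->
  exists p : 'I_m -> 'I_r, forall x y, adj G x y -> p x != p y.
Proof.
move=> gF [uv0 cuv0 c0P] gG freeG Dq DM leM hV hdeg hD.
have r0 : 0 < r by apply: leq_ltn_trans (ltn_ord (c0 u0)).
have k0 : 0 < kF by apply: leq_ltn_trans (ltn_ord u0).
have nuv0 := adj_neq gF uv0.
pose V i := [set x | P x == i]; pose D x := [set y | adj G x y != (P x != P y)].
(* As M = 8Qq, averaging the bound on the sum of the |D x| gives |B| <= m/(4q); outside [B] a vertex
   has at most m/Q discrepancies. *)
pose Q := 4 * kF * q; pose B := [set x | m < Q * #|D x|].
have q0 : 0 < q by lia.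
have Q0 : 0 < Q by rewrite /Q; nia.
have mq : 256 * (q * kF) <= m by apply: leq_trans leM; rewrite DM; nia.
have m0 : 0 < m by nia.
have cB : 4 * (q * #|B|) <= m.
  have sB : #|B| * m <= Q * \sum_x #|D x|.
    rewrite -sum_nat_const big_distrr /= [leqRHS](bigID (mem B)) /=.
    apply: leq_trans (leq_addr _ _); apply: leq_sum => x; rewrite inE; exact: ltnW.
  have h : M * (#|B| * m) <= Q * (2 * m ^ 2).
    apply: leq_trans (leq_mul (leqnn M) sB) _.
    by rewrite mulnCA leq_pmul2l.
  rewrite -(leq_pmul2l m0) -(leq_pmul2l Q0) -(leq_pmul2l (isT : 0 < 2)).
  apply: leq_trans (leq_trans h _); last by rewrite -mulnn; lia.
  by rewrite DM -/Q; lia.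
pose b := m %/ Q.
have bQ : 4 * (q * (kF * b)) <= m.
  by apply: leq_trans (leq_trunc_div m Q); rewrite -/b /Q; lia.
have notB w : w \notin B -> #|D w| <= b.
  by rewrite inE -leqNgt leq_divRL // mulnC.
have fewD i j w : i != j -> w \in V i -> w \notin B -> #|V j :\: nbrs G w| <= b.
  move=> nij; rewrite inE => /eqP Pw /notB; apply: leq_trans; apply/subset_leq_card/subsetP => y.
  by rewrite !inE => /andP[/negPf -> /eqP ->]; rewrite Pw nij.
have big_enough X : m + 4 * (q * kF) < 4 * (q * X) -> kF * b.+1 < X.
  move=> ltX; rewrite -(ltn_pmul2l q0) -(ltn_pmul2l (isT : 0 < 4)).
  apply: leq_ltn_trans ltX; rewrite mulnS mulnDr mulnDr addnC; lia.
(* Otherwise F - u0, properly coloured by [c0], embeds into the neighbourhood of [v] outside [B],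
   and [v] serves as [u0]. *)
have fewN v : exists i, q * #|nbrs G v :&: V i| < m.
  apply/existsP; apply: contraT => /existsPn many.
  pose S i := (nbrs G v :&: V i) :\: B.
  have [||f [fS injf fG]] := @greedy_partite_embed m G r S b kF c0 gG.
  - move=> i j w nij; rewrite !inE => /and3P[wB _ /eqP wi].
    apply: leq_trans (fewD i j w nij _ _); rewrite ?inE ?wi ?wB //.
    by apply/subset_leq_card/setSD/subsetP => y; rewrite !inE => /and3P[].
  - move=> i; apply: big_enough.
    have h1 : m <= q * #|nbrs G v :&: V i| by rewrite leqNgt; apply: many.
    have h2 : #|nbrs G v :&: V i| <= #|S i| + #|B|.
      by rewrite -(cardsID B) addnC leq_add2l subset_leq_card // subsetIr.
    have h3 : q * #|nbrs G v :&: V i| <= q * #|S i| + q * #|B| by rewrite -mulnDr leq_mul2l h2 orbT.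
    move: h1 h3 cB mq m0; clear.
    move: (q * #|nbrs G v :&: V i|) (q * #|S i|) (q * #|B|) (q * kF); lia.
  have vf x : adj G v (f x) by have := fS x; rewrite !inE => /and3P[].
  exfalso; apply: (@free_embed _ EF _ G (fun w => if w == u0 then v else f w)) => //.
    move=> x y; have [->|nx] := eqVneq x u0; have [->|ny] := eqVneq y u0 => //.
    - by move=> E; have := adj_neq gG (vf y); rewrite -E eqxx.
    - by move=> E; have := adj_neq gG (vf x); rewrite E eqxx.
    exact: injf.
  move=> x y xy; have [xu|nx] := eqVneq x u0; have [yu|ny] := eqVneq y u0 => //.
  - by have := adj_neq gF xy; rewrite xu yu eqxx.
  - by rewrite adjC.
  apply: fG; apply: c0P => //; apply: contraNneq nx => E.
  have : u0 \in [set x; y] by rewrite E set21.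
  by case/set2P => Eu; [rewrite -Eu | rewrite -Eu eqxx in ny].
have /fin_all_exists[p pP] := fewN; exists p => u v uv.
apply/negP => /eqP puv.
have nuv := adj_neq gG uv.
(* Colours are swapped so that [u0] and [v0] get the colour of the part where [u] and [v] have few
   neighbours. *)
set i := p u in puv; pose c x := tperm i (c0 u0) (c0 x).
have cu : c u0 = i by rewrite /c tpermR.
have cv : c v0 = i by rewrite -cu /c cuv0.
have cP x y : adj EF x y -> [set x; y] != [set u0; v0] -> c x != c y.
  by move=> xy nxy; rewrite (inj_eq perm_inj) c0P.
(* Apart from [u0] and [v0], vertices of colour [i] are adjacent to neither, so in part [i] it
   suffices to avoid [u] and [v]. *)
pose S j := if j == i then V i :\: [set u; v] :\: B else (V j :&: (nbrs G u :&: nbrs G v)) :\: B.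
have SV j : S j \subset V j :\: B.
  rewrite /S; case: eqP => [->|_]; apply: setSD; [exact: subsetDl | exact: subsetIl].
(* The degree is nearly m - m/r, so each non-neighbour outside part [i], up to one, is paid for by a
   neighbour inside it. *)
have few_outside w j : p w = i -> j != i -> #|V j :\: nbrs G w| <= (#|nbrs G w :&: V i|).+1.
  move=> pw nji.
  have h1 : #|V j :\: nbrs G w| <= #|~: V i :\: nbrs G w|.
    by apply/subset_leq_card/setSD/subsetP => y; rewrite !inE => /eqP ->.
  have h2 := cardsID (nbrs G w) (~: V i).
  have h3 := cardsID (V i) (nbrs G w).
  have h4 := cardsC (V i); rewrite card_ord in h4.
  have h5 : #|~: V i :&: nbrs G w| = #|nbrs G w :\: V i| by rewrite setDE setIC.
  have h6 := hV i; have h7 := hdeg w; rewrite /turan_mindeg in h7.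
  have h8 : m.-1 %/ r <= m %/ r by rewrite leq_div2r // leq_pred.
  rewrite -/(V i) in h6; lia.
(* A part has about 8m/q vertices or more; [B] removes at most m/(4q), and each of [u] and [v] at
   most about m/q. *)
have sizeS j : m + 4 * (q * kF) < 4 * (q * #|S j|).
  have hVq : 8 * m < q * #|V j| + q.
    have h1 := hV j; have h2 := ltn_ceil m r0.
    have h3 : m < r * (#|V j|).+1.
      by apply: leq_trans h2 _; rewrite mulnC leq_mul2l ltnS h1 orbT.
    by rewrite Dq; move: h3; move: #|V j| => t; lia.
  rewrite /S; have [Dj|nji] := eqVneq j i.
    rewrite Dj in hVq; have h1 : #|V i| <= #|V i :\: [set u; v] :\: B| + #|B| + 2.
      have h2 : #|[set u; v]| = 2 by rewrite cards2 nuv.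
      have h3 := cardsID B (V i :\: [set u; v]); have h4 := cardsID [set u; v] (V i).
      have h5 := subset_leq_card (subsetIr (V i) [set u; v]).
      have h6 := subset_leq_card (subsetIr (V i :\: [set u; v]) B).
      lia.
    have h : q * #|V i| <= q * #|V i :\: [set u; v] :\: B| + q * #|B| + q * 2.
      by rewrite -!mulnDr leq_mul2l h1 orbT.
    have qk : q <= q * kF by rewrite leq_pmulr.
    move: h hVq cB mq m0 qk; clear.
    move: (q * #|V i|) (q * #|_ :\: _|) (q * #|B|) (q * kF); lia.
  have h1 := card_setIDC (V j) (nbrs G u :&: nbrs G v) B.
  have h2 : #|V j :\: (nbrs G u :&: nbrs G v)| <= #|V j :\: nbrs G u| + #|V j :\: nbrs G v|.
    by rewrite setDIr leq_card_setU.
  have h3 := few_outside u j erefl nji; have h4 := few_outside v j (esym puv) nji.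
  have h5 := pP u; have h6 := pP v; rewrite -/i in h5; rewrite -puv in h6.
  have h7 : q * #|V j| <= q * #|V j :&: (nbrs G u :&: nbrs G v) :\: B| + q * #|B|
     + (q + q * #|nbrs G u :&: V i|) + (q + q * #|nbrs G v :&: V i|).
    rewrite -!mulnS -!mulnDr leq_mul2l; apply/orP; right; lia.
  have qk : q <= q * kF by rewrite leq_pmulr.
  move: h7 h5 h6 hVq cB mq m0 qk; clear.
  move: (q * #|V j|) (q * #|_ :\: _|) (q * #|B|) (q * kF) (q * #|nbrs G u :&: V i|) (q * #|nbrs G v :&: V i|).
  lia.
have [||f [fS injf fG]] := @greedy_partite_embed m G r S b kF c gG.
- move=> j l w njl wS; have := subsetP (SV j) w wS; rewrite inE => /andP[wB wV].
  apply: leq_trans (fewD j l w njl wV wB); apply/subset_leq_card/setSD.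
  exact: subset_trans (SV l) (subsetDl _ _).
- by move=> j; apply: big_enough.
have out x : (f x != u) && (f x != v).
  have := fS x; rewrite /S; case: eqP => _; rewrite !inE.
    by case/and3P => _; rewrite negb_or.
  case/and4P => _ _ ux vx; rewrite ![f x == _]eq_sym.
  by rewrite (adj_neq gG ux) (adj_neq gG vx).
have bad x : c x != i -> adj G u (f x) && adj G v (f x).
  by move=> nx; have := fS x; rewrite /S (negPf nx) !inE => /and4P[_ _ -> ->].
apply: (@free_embed _ EF _ G (fun w => if w == u0 then u else if w == v0 then v else f w)) => //.
  move=> x y; have [/negPf fxu /negPf fxv] := andP (out x); have [fyu fyv] := andP (out y).
  have [->|nx] := eqVneq x u0; have [->|ny] := eqVneq y u0 => //.
  - have [_ E|_ E] := eqVneq y v0; first by rewrite E eqxx in nuv.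
    by rewrite -E eqxx in fyu.
  - have [_ E|_ E] := eqVneq x v0; first by rewrite E eqxx in nuv.
    by rewrite -E eqxx in fxu.
  have [->|nx'] := eqVneq x v0; have [->|ny'] := eqVneq y v0 => //.
  - by move=> E; rewrite -E eqxx in fyv.
  - by move=> E; rewrite -E eqxx in fxv.
  exact: injf.
have Hu y : y != u0 -> y != v0 -> adj EF u0 y -> adj G u (f y).
  move=> nu nv uy; have : c y != i.
    rewrite -cu eq_sym; apply: cP => //; apply: contraNneq nv => E.
    have: y \in [set u0; v0] by rewrite -E set22.
    by case/set2P => Ey; [rewrite Ey eqxx in nu | rewrite Ey].
  by case/bad/andP.
have Hv y : y != u0 -> y != v0 -> adj EF v0 y -> adj G v (f y).
  move=> nu nv vy; have : c y != i.
    rewrite -cv eq_sym; apply: cP => //; apply: contraNneq nu => E.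
    have: y \in [set u0; v0] by rewrite -E set22.
    by case/set2P => Ey; [rewrite Ey | rewrite Ey eqxx in nv].
  by case/bad/andP.
move=> x y xy; have nxy := adj_neq gF xy.
have [xu|nxu] := eqVneq x u0; have [yu|nyu] := eqVneq y u0.
- by rewrite xu yu eqxx in nxy.
- by have [//|nyv] := eqVneq y v0; apply: Hu => //; rewrite -xu.
- by have [xv|nxv] := eqVneq x v0; rewrite adjC //; apply: Hu => //; rewrite -yu adjC.
have [xv|nxv] := eqVneq x v0; have [yv|nyv] := eqVneq y v0.
- by rewrite xv yv eqxx in nxy.
- by apply: Hv => //; rewrite -xv.
- by rewrite adjC; apply: Hv => //; rewrite -yv adjC.
apply: fG; apply: cP => //; apply: contraNneq nxu => E.
have : u0 \in [set x; y] by rewrite E set21.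
by case/set2P => Eu; [rewrite -Eu | rewrite -Eu eqxx in nyu].
Qed.

(** * Graphs of large minimum degree *)

Lemma sum_card_nbrs n (E : graph n) : is_graph E -> \sum_x #|nbrs E x| <= 2 * #|E|.
Proof.
move=> gE; have le_x x : #|nbrs E x| <= \sum_(e in E) (x \in e).
  have inj : {in nbrs E x &, injective (fun y => [set x; y])}.
    move=> y z; rewrite !inE => xy _ Eyz; have := adj_neq gE xy.
    have: y \in [set x; z] by rewrite -Eyz set22.
    by case/set2P => // ->; rewrite eqxx.
  rewrite -(card_in_imset inj) -big_mkcondr sum1_card; apply/subset_leq_card/subsetP => e.
  by case/imsetP => y; rewrite inE => xy ->; rewrite unfold_in; apply/andP; split; rewrite ?set21.
apply: (@leq_trans (\sum_x \sum_(e in E) (x \in e))); first by apply: leq_sum => x _.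
rewrite exchange_big /= mulnC -sum_nat_const.
apply: leq_sum => e eE; rewrite -(eqP (forall_inP gE e eE)) -sum1_card [leqRHS]big_mkcond /=.
by apply: leq_sum => x _; case: (x \in e).
Qed.

Lemma card_mod_class m r i : i < r -> m %/ r <= #|[set x : 'I_m | x %% r == i]|.
Proof.
move=> ltir; have lt_m (j : 'I_(m %/ r)) : i + r * j < m.
  have := leq_trunc_div m r; have := ltn_ord j; nia.
have injg : injective (fun j : 'I_(m %/ r) => Ordinal (lt_m j)).
  move=> j l /(congr1 val) /= /addnI/eqP; rewrite eqn_pmul2l; last by lia.
  by move/eqP/val_inj.
rewrite -[leqLHS]card_ord -cardsT -(card_imset _ injg); apply/subset_leq_card/subsetP.
by move=> _ /imsetP[j _ ->]; rewrite inE /= addnC mulnC modnMDl modn_small.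
Qed.

Lemma card_nbrs_turan m r (x : 'I_m) : 0 < r -> #|nbrs (turan m r) x| <= (turan_mindeg r m).+1.
Proof.
move=> r0; have h1 := card_mod_class m (ltn_pmod x r0).
have h2 := cardsC [set y : 'I_m | y %% r == x %% r]; rewrite card_ord in h2.
have h3 : #|nbrs (turan m r) x| <= #|~: [set y : 'I_m | y %% r == x %% r]|.
  by apply/subset_leq_card/subsetP => y; rewrite !inE adj_turan eq_sym.
have h4 : m.-1 %/ r <= m %/ r by rewrite leq_div2r // leq_pred.
have := ltn_ord x; rewrite /turan_mindeg; clear -h1 h2 h3 h4; lia.
Qed.

Lemma adj_perm_graph n (s : {perm 'I_n}) (E : graph n) x y :
  adj (perm_graph s E) (s x) (s y) = adj E x y.
Proof.
by rewrite /adj /perm_graph -imset_pair mem_imset //; apply/imset_inj/perm_inj.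
Qed.

(** The degree condition gives nearly as many copies of H as in the Turan graph, which by goodness
    is the maximum; stability then supplies the closeness needed for [near_turan_partite]. *)
Lemma stable_good_partite kH (EH : graph kH) kF (EF : graph kF)
    (c0 : 'I_kF -> 'I_(chi EF).-1) u0 v0 :
  is_graph EF -> is_graph EH -> forest EH -> one_bad_edge EF c0 u0 v0 ->
  turan_stable EH EF -> turan_good EH EF ->
  exists m0, forall m (G : graph m), m0 <= m -> is_graph G -> is_free EF G ->
    (forall x, turan_mindeg (chi EF).-1 m <= #|nbrs G x|) ->
    #|G| <= turan_size (chi EF).-1 m.
Proof.
move=> gF gH fH bad stable [_ [n1 good]].
set r := (chi EF).-1 in c0 bad *.
have r0 : 0 < r by apply: leq_ltn_trans (ltn_ord (c0 u0)).
have k0 : 0 < kF by apply: leq_ltn_trans (ltn_ord u0).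
pose q := 8 * r; pose M := 8 * (4 * kF * q) * q.
have M0 : 0 < M by rewrite !muln_gt0 k0 r0.
have MR0 : (0 < M%:R^-1 :> rat)%R by rewrite invr_gt0 ltr0n.
have [delta [delta0 [n2 stab]]] := stable _ MR0.
pose C := kH ^ 2 + #|EH|.
(* Beyond [K] the counting error C m^(kH-1) is at most delta m^kH. *)
pose K := Num.bound (C%:R / delta)%R.
exists (n1 + n2 + M + K) => m G le_m gG freeG degG.
have m0 : 0 < m by lia.
have degT (x : 'I_m) : #|nbrs (turan m r) x| <= (turan_mindeg r m).+1 by apply: card_nbrs_turan.
have ltd : turan_mindeg r m < m by rewrite -[ltnRHS](prednK m0) ltnS leq_subr.
have hN := Ncount_forest_le gH fH m0 ltd degG degT.
have le2 : n2 <= m by lia.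
have [|s Hs] := stab m le2 G gG freeG.
  rewrite good; last by lia.
  rewrite -/r lerBlDr -(ler_pM2l (_ : 0 < m%:R)%R) ?ltr0n // mulrDr.
  have hNR : ((m * Ncount EH (turan m r))%:R <= (m * Ncount EH G + C * m ^ kH)%:R :> rat)%R.
    by rewrite ler_nat.
  move: hNR; rewrite natrD !natrM => /le_trans; apply; rewrite lerD2l mulrA natrX.
  rewrite ler_wpM2r ?exprn_ge0 ?ler0n // -ler_pdivrMr //.
  apply: ltW; apply: lt_le_trans (archi_boundP _) _; first by rewrite divr_ge0 ?ler0n // ltW.
  by rewrite ler_nat -/K; lia.
pose T' := perm_graph s (turan m r).
have edit : M * edit_dist G T' <= m ^ 2.
  by move: Hs; rewrite -/r ler_pdivlMl ?ltr0n // -natrX -natrM ler_nat.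
pose P (x : 'I_m) := Ordinal (ltn_pmod ((s^-1)%g x) r0).
have adjT' x y : adj T' x y = (P x != P y).
  by rewrite -{1}(permKV s x) -{1}(permKV s y) adj_perm_graph adj_turan -val_eqE.
have gT' : is_graph T'.
  apply/forall_inP => e /imsetP[e' e'T ->]; rewrite card_imset; last exact: perm_inj.
  exact: (forall_inP (turan_graph m r)).
have leM : M <= m by lia.
have [||p pP] := near_turan_partite gF bad gG freeG (erefl q) (erefl M) leM (P := P) _ degG.
- move=> i; apply: leq_trans (card_mod_class m (ltn_ord i)) _.
  rewrite -(card_imset _ (@perm_inj _ s)); apply/subset_leq_card/subsetP => _ /imsetP[x + ->].
  by rewrite !inE -val_eqE /= permK.
- have gD : is_graph ((G :\: T') :|: (T' :\: G)).
    apply/forall_inP => e; rewrite !inE => /orP[] /andP[_]; first exact: (forall_inP gG).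
    exact: (forall_inP gT').
  have := sum_card_nbrs gD.
  (* The discrepancies are the degrees in the symmetric difference, so they sum to at most twice the
     edit distance. *)
  rewrite (eq_bigr (fun x => #|[set y | adj G x y != (P x != P y)]|)); last first.
    move=> x _; apply: eq_card => y; rewrite !inE -adjT' /adj !inE.
    by case: (_ \in G); case: (_ \in T').
  move=> h; apply: leq_trans (leq_mul (leqnn M) h) _.
  by rewrite mulnCA leq_mul2l.
rewrite -(edges_inT G) -[m in leqRHS]card_ord -cardsT.
exact: partite_edges_in pP.
Qed.

(** Relabelling [W] by its enumeration allows results on graphs over an ordinal to be applied to a
    vertex subset. *)
Lemma induced_subgraph n (G : graph n) (W : {set 'I_n}) : is_graph G ->
  exists G' : graph #|W|,
    [/\ is_graph G', forall kF (EF : graph kF), is_free EF G -> is_free EF G',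
        #|edges_in G W| <= #|G'| &
        forall i, exists2 x, x \in W & #|nbrs G x :&: W| <= #|nbrs G' i|].
Proof.
move=> gG; pose v := @enum_val _ (mem W); have injv : injective v by apply: enum_val_inj.
have vW x : x \in W -> exists i, v i = x.
  by move=> xW; exists (enum_rank_in xW x); rewrite /v enum_rankK_in.
exists [set e : {set 'I_#|W|} | v @: e \in G]; split.
- apply/forall_inP => e; rewrite inE => /(forall_inP gG); by rewrite card_imset.
- move=> kF EF; apply: contraLR => /containsP[f injf fE]; apply/containsP.
  exists [ffun x => v (f x)]; first by move=> x y; rewrite !ffunE => /injv /injf.
  by move=> e /fE; rewrite inE -imset_comp (eq_imset (g := [ffun x => v (f x)])) // => x; rewrite ffunE.
- rewrite -(card_imset _ (imset_inj injv)); apply/subset_leq_card/subsetP => e.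
  rewrite inE => /andP[eG /subsetP eW].
  have Ee : v @: (v @^-1: e) = e.
    apply/setP => x; apply/imsetP/idP => [[i]|xe]; first by rewrite inE => ? ->.
    by have [i vi] := vW x (eW x xe); exists i; rewrite ?inE ?vi.
  by apply/imsetP; exists (v @^-1: e); rewrite // inE Ee.
move=> i; exists (v i); first exact: enum_valP.
rewrite -(card_imset _ injv); apply/subset_leq_card/subsetP => x; rewrite !inE => /andP[vx xW].
have [j vj] := vW x xW; apply/imsetP; exists j => //.
by rewrite !inE /adj inE imset_pair vj.
Qed.

Lemma stable_good_edges kH (EH : graph kH) kF (EF : graph kF)
    (c0 : 'I_kF -> 'I_(chi EF).-1) u0 v0 :
  is_graph EF -> is_graph EH -> forest EH -> one_bad_edge EF c0 u0 v0 ->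
  turan_stable EH EF -> turan_good EH EF ->
  exists n0, forall n (G : graph n), n0 <= n -> is_graph G -> is_free EF G ->
    #|G| <= #|turan n (chi EF).-1|.
Proof.
move=> gF gH fH bad stable good.
have [m0 m0P] := stable_good_partite gF gH fH bad stable good.
set r := (chi EF).-1 in c0 bad m0P *.
have r0 : 0 < r by apply: leq_ltn_trans (ltn_ord (c0 u0)).
(* If |W| < m0, the excess gained by the deletions would be over m0^2, more than the |W|^2 that
   bounds the edges in [W]. *)
exists (m0 ^ 2 + m0) => n G le_n gG freeG; rewrite leqNgt; apply/negP => ltG.
have [|W exW degW] := @mindeg_subgraph n G r setT 0 gG.
  rewrite addn0 edges_inT cardsT card_ord.
  exact: leq_ltn_trans (turan_size_le n r0) ltG.
rewrite addn0 cardsT card_ord in exW.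
have sq := edges_in_le_sqr W gG.
have [G' [gG' freeG' le_e le_d]] := induced_subgraph W gG.
have le_m : m0 <= #|W|.
  rewrite leqNgt; apply/negP => lt_m.
  move: exW sq le_n lt_m; move: #|edges_in G W| #|W| (turan_size _ _) => e w t.
  clear; nia.
have := m0P _ G' le_m gG' (freeG' _ _ freeG).
rewrite leqNgt => /(_ _)/negP[].
  by move=> i; have [x xW] := le_d i; apply: leq_trans; apply: degW.
by apply: leq_trans (leq_trans exW le_e); rewrite ltnS leq_addr.
Qed.

Lemma Ncount_set0 k n (G1 G2 : graph n) : Ncount (set0 : graph k) G1 = Ncount (set0 : graph k) G2.
Proof.
apply: eq_card => p; rewrite !inE; apply: andb_id2l => /existsP[f /and3P[_ _ /eqP ->]].
by rewrite imset0 !sub0set.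
Qed.

Lemma Ncount_set0_gt0 k n (G : graph n) : k <= n -> 0 < Ncount (set0 : graph k) G.
Proof.
move=> le_kn; have inj : injective (widen_ord le_kn) by move=> x y /(congr1 val) /= /val_inj.
apply/card_gt0P; pose f : {ffun 'I_k -> 'I_n} := finfun (widen_ord le_kn).
exists (f @: setT, set0); rewrite inE sub0set andbT; apply/existsP; exists f.
by rewrite /= imset0 !eqxx !andbT; apply/injectiveP => x y; rewrite !ffunE => /inj.
Qed.

Theorem theorem1p6 (kF : nat) (EF : graph kF) (kH : nat) (EH : graph kH) :
  is_graph EF -> is_graph EH ->
  chi EH < chi EF ->
  forest EH ->
  turan_stable EH EF ->
  turan_good EH EF ->
  (exists C n1, forall n, n1 <= n -> biex n EF <= C) ->
  exists n0, forall n, n0 <= n ->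
    exists EG : graph n,
      [/\ is_graph EG, is_free EF EG, #|EG| = ex n EF & exH n EH EF = Ncount EH EG].
Proof.
move=> gF gH lt_chi fH stable good _.
have [n1 goodP] := good.2.
have [EH0|H0] := eqVneq EH set0.
  exists (n1 + kH) => n le_n; rewrite goodP; last by lia.
  (* Without F-free graphs the empty maximum [exH] would be 0, but goodness equates it with a
     positive count. *)
  have [E0 freeE0] : exists E0 : graph n, is_graph E0 && is_free EF E0.
    apply/existsP; apply: contraT => /existsPn no.
    have := goodP n (leq_trans (leq_addr _ _) le_n).
    rewrite /exH big_pred0; last by move=> E; apply/negbTE/no.
    have := @Ncount_set0_gt0 kH n (turan n (chi EF).-1); rewrite EH0 => lt E.
    by move: lt; rewrite -E => /(_ (leq_trans (leq_addl _ _) le_n)).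
  have [|E /andP[gE freeE] maxE] := @eq_bigmax_cond _ (fun E : graph n => is_graph E && is_free EF E) (fun E => #|E|).
    by apply/card_gt0P; exists E0.
  by exists E; rewrite EH0; split=> //; apply: Ncount_set0.
have [c [u [v bad]]] := good_critical gH gF fH H0 good.
have [n2 n2P] := stable_good_edges gF gH fH bad stable good.
have r0 : 0 < (chi EF).-1 by apply: leq_ltn_trans (ltn_ord (c u)).
exists (n1 + n2) => n le_n; have gT := turan_graph n (chi EF).-1.
have freeT : is_free EF (turan n (chi EF).-1) by apply: turan_free => //; lia.
exists (turan n (chi EF).-1); split=> //; last by apply: goodP; lia.
apply/eqP; rewrite eqn_leq; apply/andP; split.
  by apply: (@leq_bigmax_cond _ _ (fun E : graph n => #|E|)); rewrite gT.
by apply/bigmax_leqP => E /andP[gE freeE]; apply: n2P => //; lia.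
Qed.
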